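(* Let $C$ be a (uniform) coloured Petri net without deadlocks (no reachable marking of its unfolding $U$ is dead), let $S$ be its skeleton, and let $\mu$ be the net morphism from $U$ to $S$ with $\mu([p,c])=p$, $\mu([t,g])=t$, extended to markings by $\mu(m_U)(p)=\sum_{c\in\chi(p)}m_U([p,c])$. Then the abstraction function $\sigma$ with $\sigma(m_U)=\mu(m_U)$ induces a simulation relation between the markings of $U$ and $S$: for all reachable markings $m_U,m_{U1}$ of $U$ with $m_U\xrightarrow{*}m_{U1}$ in the reachability graph of $U$, there exists a reachable marking $m_{S1}$ of $S$ with $\mu(m_U)\xrightarrow{*}m_{S1}$ in the reachability graph of $S$ and $\mu(m_{U1})=m_{S1}$ (in addition to the abstraction property that $m_S\models a_S$ iff all $m_U$ with $\mu(m_U)=m_S$ satisfy the unfolded proposition $a_U$).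
   Context: A coloured Petri net $C=[P_C,T_C,F_C,W_C,\chi,\gamma,m_{0C}]$ has finite disjoint sets of places $P_C$ and transitions $T_C$, arcs $F_C$, a weight function $W_C$ assigning a finite set of variables to each arc, colour domains $\chi(p)$ (finite sets), guards $\gamma(t)$ (Boolean predicates over the variables on arcs adjacent to $t$), and an initial marking assigning a multiset over $\chi(p)$ to each place. A firing mode $g$ of $t$ assigns to each variable on an arc between $t$ and place $p$ a colour in $\chi(p)$. The unfolding $U$ is the place/transition net with places $[p,c]$ ($c\in\chi(p)$), transitions $[t,g]$ for firing modes $g\models\gamma(t)$, weights $W_U([p,c],[t,g])=|\{x\in W_C(p,t):g(x)=c\}|$, $W_U([t,g],[p,c])=|\{x\in W_C(t,p):g(x)=c\}|$, and initial marking $m_{0U}([p,c])=m_{0C}(p)(c)$. The skeleton $S$ has places $P_C$, transitions $T_C$, arcs $F_C$, weights $|W_C(x,y)|$ and initial marking $m_{0S}(p)=\sum_c m_{0C}(p)(c)$. In a place/transition net, $t$ is enabled at $m$ iff $W(p,t)\le m(p)$ for all $p$, and firing yields $m'(p)=m(p)-W(p,t)+W(t,p)$; the reachability graph has the reachable markings as states and an edge $m\xrightarrow{t}m'$ for each firing; $\xrightarrow{*}$ denotes reachability by a finite firing sequence; each dead marking gets a silent self-loop. Atomic propositions are expressions $k_1p_1+\dots+k_np_n\le k$ ($k_i,k\in\mathbb{Z}$), satisfied by $m$ iff $\sum k_i m(p_i)\le k$; the unfolding $a_U$ of a proposition over places of $C$ replaces each $p$ by $\sum_{c\in\chi(p)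}[p,c]$.
   Formalization: The abstraction property is stated for markings m_S with no tokens on places whose colour domain is empty; otherwise no m_U maps to m_S and the ''iff'' fails. The condition is void when all colour domains are nonempty. *)

(* Defs.v *)
From HB Require Import structures.
From mathcomp Require Import all_boot all_order all_algebra.

Set Implicit Arguments.
Unset Strict Implicit.
Unset Printing Implicit Defensive.

Import Order.TTheory GRing.Theory Num.Theory.

(* Arcs and weights are split into their place-to-transition part (pre) and
   their transition-to-place part (post); weights are total and vanish off the
   arcs. *)
Record pt_net := PTNet {
  place : finType;
  trans : finType;
  arc_pre : place -> trans -> bool;
  arc_post : trans -> place -> bool;
  w_pre : place -> trans -> nat;
  w_post : trans -> place -> nat;
  w_pre_arc : forall p t, ~~ arc_pre p t -> w_pre p t = 0;
  w_post_arc : forall t p, ~~ arc_post t p -> w_post t p = 0;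
  m0 : {ffun place -> nat}
}.

Definition marking (N : pt_net) := {ffun place N -> nat}.

Definition enabled (N : pt_net) (m : marking N) (t : trans N) : Prop :=
  forall p, w_pre p t <= m p.

Definition fires (N : pt_net) (m : marking N) (t : trans N)
    (m' : marking N) : Prop :=
  enabled m t /\ forall p, m' p = m p - w_pre p t + w_post t p.

Definition dead (N : pt_net) (m : marking N) : Prop :=
  forall t, ~ enabled m t.

Fixpoint firing_seq (N : pt_net) (m : marking N) (s : seq (trans N))
    (m' : marking N) : Prop :=
  match s with
  | [::] => m' = m
  | t :: s' => exists2 m1, fires m t m1 & firing_seq m1 s' m'
  end.

Definition reachable (N : pt_net) (m : marking N) : Prop :=
  exists s, firing_seq (m0 N) s m.

(* Label None is the silent action. *)
Inductive rg_edge (N : pt_net) :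
    marking N -> option (trans N) -> marking N -> Prop :=
| RgFire m t m' : reachable m -> fires m t m' -> rg_edge m (Some t) m'
| RgSilent m : reachable m -> dead m -> rg_edge m None m.

Fixpoint rg_path (N : pt_net) (m : marking N) (s : seq (option (trans N)))
    (m' : marking N) : Prop :=
  match s with
  | [::] => reachable m /\ m' = m
  | l :: s' => exists2 m1, rg_edge m l m1 & rg_path m1 s' m'
  end.

(* The arrow with a star: a path of the reachability graph whose labels form a
   firing sequence (possibly empty).  Both end points are reachable markings. *)
Definition rg_star (N : pt_net) (m m' : marking N) : Prop :=
  exists s : seq (trans N), rg_path m [seq Some t | t <- s] m'.

Definition deadlock_free (N : pt_net) : Prop :=
  forall m : marking N, reachable m -> ~ dead m.

(* Since there are finitely many nodes, all colour domains live in one finite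
   type and so do all variables.  A valuation for t only assigns values to the
   variables on arcs adjacent to t, so distinct firing modes differ on such a
   variable. *)
Definition adj_vars (P T : finType) (V : finType)
    (W_pre : P -> T -> {set V}) (W_post : T -> P -> {set V}) (t : T) : {set V} :=
  \bigcup_p (W_pre p t :|: W_post t p).

Definition valuation (V Col : finType) (X : {set V}) :=
  {ffun {x : V | x \in X} -> Col}.

Record col_net := ColNet {
  cplace : finType;
  ctrans : finType;
  var : finType;
  col : finType;
  carc_pre : cplace -> ctrans -> bool;
  carc_post : ctrans -> cplace -> bool;
  cw_pre : cplace -> ctrans -> {set var};
  cw_post : ctrans -> cplace -> {set var};
  cw_pre_arc : forall p t, ~~ carc_pre p t -> cw_pre p t = set0;
  cw_post_arc : forall t p, ~~ carc_post t p -> cw_post t p = set0;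
  chi : cplace -> {set col};
  guard : forall t, pred (valuation col (adj_vars cw_pre cw_post t));
  cm0 : forall p, {ffun {c : col | c \in chi p} -> nat}
}.

Definition vars (C : col_net) (t : ctrans C) : {set var C} :=
  adj_vars (@cw_pre C) (@cw_post C) t.

Definition colour (C : col_net) (p : cplace C) := {c : col C | c \in chi p}.

(* A variable occurring on arcs to several places must take its value in each
   of their colour domains. *)
Definition is_mode (C : col_net) (t : ctrans C)
    (g : valuation (col C) (vars t)) : bool :=
  [forall p, forall x : {x : var C | x \in vars t},
     (val x \in cw_pre p t :|: cw_post t p) ==> (g x \in chi p)].

Definition uplace (C : col_net) := {p : cplace C & colour p}.

Definition utrans (C : col_net) :=
  {t : ctrans C & {g : valuation (col C) (vars t) | is_mode g && guard g}}.

Definition uw_pre (C : col_net) (pc : uplace C) (tg : utrans C) : nat :=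
  #|[set x : {x : var C | x \in vars (tag tg)} |
      (val x \in cw_pre (tag pc) (tag tg))
      && (val (tagged tg) x == val (tagged pc))]|.

Definition uw_post (C : col_net) (tg : utrans C) (pc : uplace C) : nat :=
  #|[set x : {x : var C | x \in vars (tag tg)} |
      (val x \in cw_post (tag tg) (tag pc))
      && (val (tagged tg) x == val (tagged pc))]|.

Lemma uw_pre_arc (C : col_net) (pc : uplace C) (tg : utrans C) :
  ~~ (0 < uw_pre pc tg) -> uw_pre pc tg = 0.
Proof. by rewrite -eqn0Ngt => /eqP. Qed.

Lemma uw_post_arc (C : col_net) (tg : utrans C) (pc : uplace C) :
  ~~ (0 < uw_post tg pc) -> uw_post tg pc = 0.
Proof. by rewrite -eqn0Ngt => /eqP. Qed.

Definition unfolding (C : col_net) : pt_net :=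
  @PTNet (uplace C) (utrans C)
    (fun pc tg => 0 < uw_pre pc tg) (fun tg pc => 0 < uw_post tg pc)
    (@uw_pre C) (@uw_post C) (@uw_pre_arc C) (@uw_post_arc C)
    [ffun pc : uplace C => cm0 (tag pc) (tagged pc)].

Lemma sw_pre_arc (C : col_net) (p : cplace C) (t : ctrans C) :
  ~~ carc_pre p t -> #|cw_pre p t| = 0.
Proof. by move=> /cw_pre_arc ->; rewrite cards0. Qed.

Lemma sw_post_arc (C : col_net) (t : ctrans C) (p : cplace C) :
  ~~ carc_post t p -> #|cw_post t p| = 0.
Proof. by move=> /cw_post_arc ->; rewrite cards0. Qed.

Definition skeleton (C : col_net) : pt_net :=
  @PTNet (cplace C) (ctrans C) (@carc_pre C) (@carc_post C)
    (fun p t => #|cw_pre p t|) (fun t p => #|cw_post t p|)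
    (@sw_pre_arc C) (@sw_post_arc C)
    [ffun p => \sum_(c : colour p) cm0 p c].

Definition mu_place (C : col_net) (q : place (unfolding C)) :
    place (skeleton C) := tag (q : uplace C).

Definition mu_trans (C : col_net) (u : trans (unfolding C)) :
    trans (skeleton C) := tag (u : utrans C).

(* The places of U over p are exactly the [p, c] with c in chi p. *)
Definition mu (C : col_net) (m : marking (unfolding C)) :
    marking (skeleton C) :=
  [ffun p : place (skeleton C) =>
     \sum_(c : colour p) m (Tagged (@colour C) c)].

Record atomic (P : Type) := Atomic {
  terms : seq (int * P);
  bound : int
}.

Definition sat (N : pt_net) (m : marking N) (a : atomic (place N)) : Prop :=
  (\sum_(kp <- terms a) kp.1 * (m kp.2)%:Z <= bound a)%R.

Definition unfold_atomic (C : col_net) (a : atomic (place (skeleton C))) :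
    atomic (place (unfolding C)) :=
  Atomic
    (flatten [seq [seq (kp.1, Tagged (@colour C) c : place (unfolding C))
                  | c <- enum {: colour kp.2}]
             | kp <- terms a])
    (bound a).

(* Main.v *)
(** A firing mode of [t] sends every variable on an arc between [p] and [t] to
    a colour of [p], so the weights of [[t,g]] summed over the copies [[p,c]]
    of [p] give back the weight of [t] in the skeleton.  Hence [mu] maps firings
    to firings, and by induction paths to paths.  For the propositions,
    satisfaction of [a_U] at [m] is satisfaction of [a_S] at [mu m], and every
    marking of the skeleton that vanishes on the places without colours is in
    the image of [mu]. *)
Require Import Defs.
From mathcomp Require Import all_boot all_order all_algebra.

Set Implicit Arguments.
Unset Strict Implicit.
Unset Printing Implicit Defensive.

Import GRing.Theory.

(** Double counting: each [x] in [A] lies in exactly one fibre of [g], the one over [g x], and this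
    value is a colour in [D]. Since [A] is contained in [X], no element of [A] is lost in the
    subtype. *)
Lemma sum_card_fibers (V K : finType) (X A : {set V}) (D : {set K})
    (g : {x : V | x \in X} -> K) :
  A \subset X -> (forall x, val x \in A -> g x \in D) ->
  \sum_(c : {c : K | c \in D})
     #|[set x : {x : V | x \in X} | (val x \in A) && (g x == val c)]| = #|A|.
Proof.
move=> sAX gD.
transitivity (\sum_(c : {c : K | c \in D})
    \sum_(x : {x : V | x \in X} | (val x \in A) && (g x == val c)) 1).
  by apply: eq_bigr => c _; rewrite -sum1_card; apply: eq_bigl => x; rewrite inE.
rewrite (exchange_big_dep (fun x => val x \in A)) /=; last by move=> c x _ /andP[].
transitivity #|[set x : {x : V | x \in X} | val x \in A]|.
  rewrite -sum1_card; apply: eq_big => [x|x Ax]; first by rewrite inE.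
  rewrite (big_pred1 (Sub (g x) (gD x Ax))) // => c.
  by rewrite Ax /= eq_sym -(inj_eq val_inj).
rewrite -(card_imset _ val_inj); apply: eq_card => v.
apply/imsetP/idP => [[x + ->]|Av]; first by rewrite inE.
by exists (Sub v (subsetP sAX v Av)); rewrite ?inE.
Qed.

Section Projection.

Variable C : col_net.

Local Notation U := (unfolding C).
Local Notation S := (skeleton C).

Lemma arc_vars_sub (p : cplace C) (t : ctrans C) :
  cw_pre p t :|: cw_post t p \subset vars t.
Proof. exact: (bigcup_sup p). Qed.

Lemma mode_colour (tg : utrans C) (p : cplace C)
    (x : {x : var C | x \in vars (tag tg)}) :
  val x \in cw_pre p (tag tg) :|: cw_post (tag tg) p ->
  val (tagged tg) x \in chi p.
Proof.
case/andP: (valP (tagged tg)) => /forallP/(_ p)/forallP/(_ x)/implyP mode_g _.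
exact: mode_g.
Qed.

Lemma sum_uw_pre (tg : utrans C) (p : cplace C) :
  \sum_(c : colour p) uw_pre (Tagged (@colour C) c) tg = #|cw_pre p (tag tg)|.
Proof.
apply: (sum_card_fibers (X := vars (tag tg)) (A := cw_pre p (tag tg)) (D := chi p)
  (g := fun x => val (tagged tg) x)) => [|x Ax].
  exact: subset_trans (subsetUl _ _) (arc_vars_sub _ _).
by apply: mode_colour; rewrite inE Ax.
Qed.

Lemma sum_uw_post (tg : utrans C) (p : cplace C) :
  \sum_(c : colour p) uw_post tg (Tagged (@colour C) c) = #|cw_post (tag tg) p|.
Proof.
apply: (sum_card_fibers (X := vars (tag tg)) (A := cw_post (tag tg) p) (D := chi p)
  (g := fun x => val (tagged tg) x)) => [|x Ax].
  exact: subset_trans (subsetUr _ _) (arc_vars_sub _ _).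
by apply: mode_colour; rewrite inE Ax orbT.
Qed.

Lemma mu_m0 : mu (m0 U) = m0 S.
Proof.
by apply/ffunP => p; rewrite !ffunE; apply: eq_bigr => c _; rewrite ffunE.
Qed.

Lemma mu_fires (m m' : marking U) (u : trans U) :
  fires m u m' -> fires (mu m) (mu_trans u) (mu m').
Proof.
case=> en_u def_m'; split=> p; rewrite !ffunE /= -sum_uw_pre.
  by apply: leq_sum => c _; apply: en_u.
(* Truncated subtraction commutes with the sum only because no term is truncated, which is
   enabledness at each copy of [p]. *)
rewrite -sum_uw_post -sumnB => [|c _]; last exact: en_u.
by rewrite -big_split /=; apply: eq_bigr => c _; rewrite def_m'.
Qed.

Lemma mu_firing_seq (s : seq (trans U)) (m m' : marking U) :
  firing_seq m s m' -> firing_seq (mu m) [seq mu_trans u | u <- s] (mu m').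
Proof.
elim: s m => [|u s IHs] m /= => [-> //|[m1 m_m1 m1_m']].
by exists (mu m1); [apply: mu_fires | apply: IHs].
Qed.

Lemma mu_reachable (m : marking U) : reachable m -> reachable (mu m).
Proof.
case=> s /mu_firing_seq; rewrite mu_m0 => m0_m.
by exists [seq mu_trans u | u <- s].
Qed.

Lemma mu_rg_star (m m' : marking U) : rg_star m m' -> rg_star (mu m) (mu m').
Proof.
case=> s m_m'; exists [seq mu_trans u | u <- s].
elim: s m m_m' => [|u s IHs] m /=.
  by case=> /mu_reachable rm ->.
case=> m1 edge_m1 /IHs m1_m'; exists (mu m1) => //.
(* The label is [Some u], so the edge is a firing and not a silent loop. *)
inversion edge_m1; subst.
by apply: RgFire; [apply: mu_reachable | apply: mu_fires].
Qed.

(** All copies of a place carry the same coefficient, which factors out and leaves the token sum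
    defining [mu m]. *)
Lemma sat_unfold_atomic (m : marking U) (a : atomic (place S)) :
  sat m (unfold_atomic a) <-> sat (mu m) a.
Proof.
rewrite /sat /= big_flatten big_map /=.
under eq_bigr => kp _.
  rewrite big_map big_enum /= -mulr_sumr.
  have -> : (\sum_(c : colour kp.2) (m (Tagged (@colour C) c))%:Z)%R
            = ((mu m kp.2)%:Z)%R.
    by rewrite ffunE (big_morph Posz PoszD (erefl _)).
  over.
by [].
Qed.

(* All the tokens of [p] are put on a single colour of [p]. *)
Lemma mu_surj (mS : marking S) :
  (forall p : cplace C, chi p = set0 -> mS p = 0) ->
  exists mU : marking U, mu mU = mS.
Proof.
move=> mS0.
pose f (pc : uplace C) :=
  if [pick c : colour (tag pc)] == Some (tagged pc) then mS (tag pc) else 0.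
exists [ffun pc : place U => f pc]; apply/ffunP => p; rewrite ffunE.
under eq_bigr => c _ do rewrite ffunE /f /=.
rewrite -big_mkcond /=; case: pickP => [c0 _|no_c].
  by rewrite (big_pred1 c0) // => c; rewrite eq_sym.
(* With no colour to pick, the sum is 0, and [mS0] gives the same value once [chi p] is shown
   empty. *)
rewrite big_pred0 // mS0 //; apply/setP => c; rewrite inE.
by apply/negP => cp; have := no_c (Sub c cp).
Qed.

End Projection.

Theorem theorem2 (C : col_net) (nodead : deadlock_free (unfolding C)) :
  (forall mU mU1 : marking (unfolding C),
     reachable mU -> reachable mU1 -> rg_star mU mU1 ->
     exists mS1 : marking (skeleton C),
       [/\ reachable mS1, rg_star (mu mU) mS1 & mu mU1 = mS1])
  /\
  (forall (mS : marking (skeleton C)) (aS : atomic (place (skeleton C))),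
     (forall p : cplace C, chi p = set0 -> mS p = 0) ->
     (sat mS aS <->
      forall mU : marking (unfolding C),
        mu mU = mS -> sat mU (unfold_atomic aS))).
Proof.
split=> [mU mU1 _ rU1 star_mU|mS aS mS0].
  by exists (mu mU1); split=> //; [apply: mu_reachable | apply: mu_rg_star].
split=> [satS mU def_mS|satU].
  by apply/sat_unfold_atomic; rewrite def_mS.
(* A preimage of [mS] keeps [satU] from being vacuous. *)
have [mU def_mS] := mu_surj mS0.
by rewrite -def_mS; apply/sat_unfold_atomic/satU.
Qed.
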